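(* Let $m$ and $n$ be relatively prime positive integers such that each group of order $mn$ has a normal subgroup of order $m$. Then each skew brace $(B,\cdot,\circ)$ of size $mn$ has an ideal $B_1$ of size $m$, hence a quotient skew brace $B/B_1$ of size $n$. Moreover, for every $x\in B$ and every $y\in B_1$, we have $\lambda_y(x)\cdot x^{-1}\in B_1$.
   Context: A skew (left) brace is a set $B$ with two operations $\cdot$ and $\circ$ such that $(B,\cdot)$ (the additive group) and $(B,\circ)$ (the multiplicative group) are groups and $a\circ(b\cdot c)=(a\circ b)\cdot a^{-1}\cdot(a\circ c)$ for all $a,b,c\in B$, where $a^{-1}$ is the inverse of $a$ in $(B,\cdot)$. For $a\in B$, $\lambda_a:B\to B$ is defined by $\lambda_a(b)=a^{-1}\cdot(a\circ b)$; it is an automorphism of $(B,\cdot)$, and $\lambda_{a\circ b}=\lambda_a\lambda_b$. An ideal of $B$ is a subset $I$ that is a normal subgroup of $(B,\cdot)$, a normal subgroup of $(B,\circ)$, and satisfies $\lambda_x(I)=I$ for all $x\in B$; then $B/I$ inherits a skew brace structure. *)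

(* Defs.v *)
From HB Require Import structures.
From mathcomp Require Import all_boot all_fingroup.

Set Implicit Arguments.
Unset Strict Implicit.
Unset Printing Implicit Defensive.

Local Open Scope group_scope.

(* The additive group (B, .) is the canonical group structure of the type, so
   x * y, x^-1 and 1 always refer to it. *)
HB.mixin Record Group_isSkewBrace B of monoid.Group B := {
  circ : B -> B -> B;
  circ_one : B;
  circ_inv : B -> B;
  circA : associative circ;
  circ1g : left_id circ_one circ;
  circg1 : right_id circ_one circ;
  circVg : left_inverse circ_one circ_inv circ;
  circgV : right_inverse circ_one circ_inv circ;
  circ_brace : forall a b c : B, circ a (b * c) = circ a b * a^-1 * circ a c
}.

#[short(type="skewBraceType")]
HB.structure Definition SkewBrace :=
  {B of Group_isSkewBrace B & monoid.Group B}.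

#[short(type="finSkewBraceType")]
HB.structure Definition FinSkewBrace :=
  {B of Group_isSkewBrace B & FinGroup B}.

Bind Scope group_scope with SkewBrace.sort.
Bind Scope group_scope with FinSkewBrace.sort.

Notation "x \circ y" := (circ x y)
  (at level 40, left associativity) : group_scope.

Definition brace_lambda (B : skewBraceType) (a b : B) : B := a^-1 * (a \circ b).

(* A copy of B whose canonical group structure is (B, o). *)
Definition circ_group (B : Type) : Type := B.

HB.instance Definition _ (B : finSkewBraceType) :=
  Finite.copy (circ_group B) B.
HB.instance Definition _ (B : finSkewBraceType) :=
  isGroup.Build (circ_group B) (@circA B) (@circ1g B) (@circg1 B)
    (@circVg B) (@circgV B).

Definition is_ideal (B : finSkewBraceType) (I : {set B}) : Prop :=
  let Ic : {set circ_group B} := I in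
  [/\ group_set I /\ I <| [set: B],
      group_set Ic /\ Ic <| [set: circ_group B]
    & forall x : B, [set brace_lambda x y | y in I] = I].

Section Quotient.

Variables (B : finSkewBraceType) (I : {set B}) (idI : is_ideal I).

(* Since I is normal in (B, .), coset_of I is the type of all cosets of I. *)
Definition brace_quotient of is_ideal I : Type := coset_of I.
Local Notation Q := (brace_quotient idI).

HB.instance Definition _ := FinGroup.copy Q (coset_of I).

Definition brace_quotient_circ (X Y : Q) : Q :=
  coset I (repr (X : {set B}) \circ repr (Y : {set B})).
Definition brace_quotient_one : Q := coset I (@circ_one B).
Definition brace_quotient_inv (X : Q) : Q :=
  coset I (circ_inv (repr (X : {set B}))).

Lemma brace_norm x : x \in 'N(I).
Proof.
by case: idI => -[_ /normal_norm/subsetP nI] _ _; apply: nI; rewrite inE.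
Qed.

Lemma brace_cosetP (a b : B) :
  coset I a = coset I b <-> exists2 i, i \in I & b = a * i.
Proof.
have [[gI _] _ _] := idI.
pose G := Group gI.
have nG x : x \in 'N(G) by apply: brace_norm.
split=> [/esym E|[i iI ->]].
  exists (a^-1 * b); last by rewrite mulKVg.
  have /rcoset_kercosetP : coset G b = coset G a := E.
  move/(_ (nG b) (nG a)); rewrite norm_rlcoset // => /lcosetP[i iG ->].
  by rewrite mulKg.
suff: coset G a = coset G (a * i) by [].
apply/(rcoset_kercosetP (nG _) (nG _)).
by rewrite norm_rlcoset // lcoset_sym; apply/lcosetP; exists i.
Qed.

Lemma brace_coset_circ_congr (a a' b b' : B) :
  coset I a = coset I a' -> coset I b = coset I b' ->
  coset I (a \circ b) = coset I (a' \circ b').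
Proof.
have [[gI _] [gIc nIc] lamI] := idI.
have circ_lam x y : x \circ y = x * brace_lambda x y by rewrite mulKVg.
have lam_in x y : y \in I -> brace_lambda x y \in I.
  by move=> yI; rewrite -(lamI x); apply: imset_f.
case/brace_cosetP=> i iI -> /brace_cosetP[j jI ->].
move: (iI); rewrite -{1}(lamI a) => /imsetP[k kI ->]; rewrite -circ_lam.
apply: (@etrans _ _ (coset I ((a \circ k) \circ b))); last first.
  apply/brace_cosetP; exists (brace_lambda (a \circ k) j); first exact: lam_in.
  by rewrite circ_brace -!mulgA.
pose kb : B := circ_inv b \circ (k \circ b).
have kbI : kb \in I.
  have /(_ b) := subsetP (normal_norm nIc).
  rewrite inE => /(_ isT); rewrite inE => /subsetP; apply.
  exact: etrans (@memJ_conjg (circ_group B) I b k) kI.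
apply/brace_cosetP; exists (brace_lambda (a \circ b) kb); first exact: lam_in.
by rewrite -circ_lam /kb -!circA (circA b) circgV circ1g.
Qed.

Lemma brace_coset_reprK (X : Q) : coset I (repr (X : {set B})) = X.
Proof. exact: coset_reprK. Qed.

Lemma brace_coset_circ (a b : B) :
  (coset I (a \circ b) : Q) = brace_quotient_circ (coset I a) (coset I b).
Proof. by apply: brace_coset_circ_congr; rewrite brace_coset_reprK. Qed.

Lemma brace_quotient_circA : associative brace_quotient_circ.
Proof.
move=> X Y Z.
rewrite -[X]brace_coset_reprK -[Y]brace_coset_reprK -[Z]brace_coset_reprK.
by rewrite -!brace_coset_circ circA.
Qed.

Lemma brace_quotient_circ1g : left_id brace_quotient_one brace_quotient_circ.
Proof.
move=> X; rewrite -[X]brace_coset_reprK /brace_quotient_one.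
by rewrite -!brace_coset_circ circ1g.
Qed.

Lemma brace_quotient_circg1 : right_id brace_quotient_one brace_quotient_circ.
Proof.
move=> X; rewrite -[X]brace_coset_reprK /brace_quotient_one.
by rewrite -!brace_coset_circ circg1.
Qed.

Lemma brace_quotient_circVg :
  left_inverse brace_quotient_one brace_quotient_inv brace_quotient_circ.
Proof.
move=> X; rewrite -{2}[X]brace_coset_reprK /brace_quotient_inv.
by rewrite -!brace_coset_circ circVg.
Qed.

Lemma brace_quotient_circgV :
  right_inverse brace_quotient_one brace_quotient_inv brace_quotient_circ.
Proof.
move=> X; rewrite -{1}[X]brace_coset_reprK /brace_quotient_inv.
by rewrite -!brace_coset_circ circgV.
Qed.

Lemma brace_quotient_circ_brace (X Y Z : Q) :
  brace_quotient_circ X (Y * Z) =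
  brace_quotient_circ X Y * X^-1 * brace_quotient_circ X Z.
Proof.
have cM (a b : B) : (coset I a : Q) * (coset I b : Q) = coset I (a * b).
  by rewrite [RHS]morphM ?brace_norm.
have cV (a : B) : (coset I a : Q)^-1 = coset I a^-1.
  by rewrite [RHS]morphV ?brace_norm.
rewrite -[X]brace_coset_reprK -[Y]brace_coset_reprK -[Z]brace_coset_reprK.
by rewrite cV cM -!brace_coset_circ !cM circ_brace.
Qed.

HB.instance Definition _ := Group_isSkewBrace.Build Q
  brace_quotient_circA brace_quotient_circ1g brace_quotient_circg1
  brace_quotient_circVg brace_quotient_circgV brace_quotient_circ_brace.

End Quotient.

(* Main.v *)
(* A normal subgroup whose order is coprime to its index is the only subgroup
   of its order. So the normal subgroup of order m of (B, .) is stable under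
   every automorphism of (B, .), in particular under the lambda_a; since
   a o b = a . lambda_a(b), it is then also a subgroup of (B, o), of order m,
   hence it is the normal subgroup of order m of (B, o). *)
Require Import Defs.
From HB Require Import structures.
From mathcomp Require Import all_boot all_fingroup.
From mathcomp Require Import pgroup.

Local Open Scope group_scope.

(** By coprimality [H] is a normal Hall subgroup of [G], so it contains every subgroup whose order
    has only prime factors of [#|H|], in particular [K]; equal orders do the rest. *)
Lemma normal_coprime_card_uniq {gT : finGroupType} {G H K : {group gT}} :
  H <| G -> coprime #|H| #|G : H| -> K \subset G -> #|K| = #|H| -> K :=: H.
Proof.
move=> nHG coHG sKG eqKH; apply/eqP; rewrite eqEcard eqKH leqnn andbT.
have /Hall_pi hallH : Hall G H by rewrite /Hall (normal_sub nHG).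
by rewrite (sub_normal_Hall hallH) // /pgroup eqKH pnat_pi ?cardG_gt0.
Qed.

Lemma circ_lambda {B : skewBraceType} (a b : B) : a \circ b = a * brace_lambda a b.
Proof. by rewrite mulKVg. Qed.

Lemma brace_lambdaM {B : skewBraceType} (a b c : B) :
  brace_lambda a (b * c) = brace_lambda a b * brace_lambda a c.
Proof. by rewrite /brace_lambda circ_brace !mulgA. Qed.

Lemma brace_lambda1 {B : skewBraceType} (a : B) : brace_lambda a 1 = 1.
Proof.
by apply: (mulgI (brace_lambda a 1)); rewrite -brace_lambdaM !mulg1.
Qed.

(** With [e] for [circ_one]: [1 = e \circ 1 = e * brace_lambda e 1 = e]. *)
Lemma circ_oneE {B : skewBraceType} : circ_one = 1 :> B.
Proof. by rewrite -[RHS]circ1g circ_lambda brace_lambda1 mulg1. Qed.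

Lemma brace_lambda_inj {B : skewBraceType} (a : B) : injective (brace_lambda a).
Proof.
move=> b c /mulgI/(congr1 (circ (circ_inv a))).
by rewrite !circA circVg !circ1g.
Qed.

Lemma group_set_lambda {B : finSkewBraceType} (x : B) (H : {group B}) :
  group_set [set brace_lambda x y | y in H].
Proof.
apply/group_setP; split; first by rewrite -(brace_lambda1 x) imset_f.
move=> _ _ /imsetP[y Hy ->] /imsetP[z Hz ->].
by rewrite -brace_lambdaM imset_f ?groupM.
Qed.

Lemma group_set_circ {B : finSkewBraceType} (H : {group B}) :
  (forall x : B, [set brace_lambda x y | y in H] = H) ->
  group_set (H : {set circ_group B}).
Proof.
move=> lamH; apply/group_setP; split.
  by have: (circ_one : B) \in H by rewrite circ_oneE group1.
move=> x y Hx Hy; suff: (x : B) \circ (y : B) \in H by [].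
by rewrite circ_lambda groupM // -(lamH x) imset_f.
Qed.

Lemma card_brace_quotient {B : finSkewBraceType} (I : {set B})
  (idI : is_ideal I) :
  #|(brace_quotient idI : finSkewBraceType)| = (#|B| %/ #|I|)%N.
Proof.
have [[gI nI] _ _] := idI; pose H := Group gI.
have := card_quotient (H := H) (normal_norm nI).
rewrite -divgS ?subsetT // cardsT => <-.
(* The type [coset_of I] is the carrier of the whole quotient group, so its cardinal is the index of
   [I]. *)
by rewrite quotientT cardsT.
Qed.

(** Let [z] be the conjugate of [y] by [x] in [circ_group B]. Computing [y \circ x = x \circ z]
    through [circ_lambda] on both sides gives [y * brace_lambda y x = x * brace_lambda x z], so the
    element is [y^-1] times an additive conjugate of [brace_lambda x z]. *)
Lemma ideal_lambda_left {B : finSkewBraceType} (I : {set B}) (x y : B) :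
  is_ideal I -> y \in I -> brace_lambda y x * x^-1 \in I.
Proof.
case=> -[gI nI] [gIc nIc] lamI Iy.
pose z : B := circ_inv x \circ (y \circ x).
have Iz : z \in I.
  have /(_ x) := subsetP (normal_norm nIc).
  rewrite inE => /(_ isT); rewrite inE => /subsetP; apply.
  exact: etrans (@memJ_conjg (circ_group B) I x y) Iy.
have Ilz : brace_lambda x z \in I by rewrite -(lamI x) imset_f.
have -> : brace_lambda y x * x^-1 = y^-1 * brace_lambda x z ^ x^-1.
  rewrite conjgE invgK (mulgA x) -circ_lambda /z circA circgV circ1g.
  by rewrite mulgA.
have Nx : x^-1 \in 'N(I) by apply: (subsetP (normal_norm nI)); rewrite inE.
by apply: (@groupM _ (Group gI)); rewrite ?groupV //= memJ_norm.
Qed.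

Theorem proposition3 (m n : nat) (m_gt0 : (0 < m)%N) (n_gt0 : (0 < n)%N)
  (co_mn : coprime m n)
  (normal_m : forall (gT : finGroupType) (G : {group gT}), #|G| = (m * n)%N ->
     exists H : {group gT}, H <| G /\ #|H| = m)
  (B : finSkewBraceType) (cardB : #|B| = (m * n)%N) :
  exists (B1 : {set B}) (idB1 : is_ideal B1),
    [/\ #|B1| = m,
        #|(brace_quotient idB1 : finSkewBraceType)| = n
      & forall x y : B, y \in B1 -> brace_lambda y x * x^-1 \in B1].
Proof.
(* The group type is left arbitrary, to serve for both [B] and [circ_group B]. *)
have exU (gT : finGroupType) : #|gT| = (m * n)%N ->
    exists2 H : {group gT}, H <| setT /\ #|H| = m &
      forall K : {group gT}, #|K| = m -> K :=: H.
  move=> cT; have cG : #|[set: gT]| = (m * n)%N by rewrite cardsT.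
  have [H [nH cH]] := normal_m gT _ cG; exists H => // K cK.
  apply: (normal_coprime_card_uniq nH); rewrite ?subsetT ?cK ?cH //.
  by rewrite -divgS ?subsetT // cG cH mulKn.
have [H [nH cH] uniqH] := exU B cardB.
have lamH x : [set brace_lambda x y | y in H] = H.
  apply: (uniqH (Group (group_set_lambda x H))).
  by rewrite -cH; apply/card_imset/brace_lambda_inj.
have gHc := group_set_circ H lamH.
have [K [nK _] uniqK] := exU (circ_group B) cardB.
have idH : is_ideal H.
  split=> //; first by split=> //; apply: groupP.
  (* Both group structures share one carrier, so [cH] also gives the order of [H] in [circ_group B];
     hence [H] is the normal subgroup [K]. *)
  by split=> //; rewrite (uniqK (Group gHc) cH : _ = _ :> {set _}).
exists H, idH; split=> // [|x y Hy]; last exact: ideal_lambda_left.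
by rewrite card_brace_quotient cardB cH mulKn.
Qed.
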